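(* For every positive integer $m$, there exist an integer $N\geq 2$ and a digit set $\mathcal{D}\subset\{0,1,\ldots,N-1\}^2$ with $1<|\mathcal{D}|<N^2$ such that the generalized Sierpiński carpet $F=F(N,\mathcal{D})$ is connected and has exactly $m$ cut points.
   Context: Let $N\geq 2$ and $\mathcal{D}\subset\{0,1,\ldots,N-1\}^2$ with $1<|\mathcal{D}|<N^2$. For $i\in\mathcal{D}$ let $\varphi_i(x)=\frac1N(x+i)$, $x\in\mathbb{R}^2$. The generalized Sierpiński carpet (GSC) $F=F(N,\mathcal{D})$ is the unique non-empty compact set with $F=\bigcup_{i\in\mathcal{D}}\varphi_i(F)$. A point $x$ of a connected topological space $X$ is a cut point of $X$ if $X\setminus\{x\}$ is disconnected. *)

(* Defs.v *)
From mathcomp Require Import all_boot all_order all_algebra.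
From mathcomp Require Import all_classical all_reals all_analysis.
Import Order.TTheory GRing.Theory Num.Theory.
Import numFieldNormedType.Exports.

Set Implicit Arguments.
Unset Strict Implicit.
Unset Printing Implicit Defensive.

Local Open Scope classical_set_scope.
Local Open Scope ring_scope.

Definition phi (R : realType) (N : nat) (i : 'I_N * 'I_N) (x : R * R) : R * R :=
  ((x.1 + i.1%:R) / N%:R, (x.2 + i.2%:R) / N%:R).

(* [is_GSC D F]: F is the unique non-empty compact subset of the plane that is
   invariant under the maps [phi i], i in D; [unique P F] also contains P F. *)
Definition is_GSC (R : realType) (N : nat) (D : {set 'I_N * 'I_N}) :
    set (R * R) -> Prop :=
  unique (fun F : set (R * R) =>
    [/\ F !=set0, compact F & F = \bigcup_(i in [set` D]) (phi i @` F)]).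

(* Subsets stand for topological spaces with the subspace topology; the library's
   [connected A] is connectedness of A for that topology (set0 is connected). *)
Definition cut_points (T : topologicalType) (X : set T) : set T :=
  [set x | X x /\ ~ connected (X `\ x)].

(* Main.v *)
(* With N = 3m + 1, keep all digits (c, r) with c = 0 mod 3, those with r <= c if
   c = 1 mod 3, and those with r >= c if c = 2 mod 3; for m = 1 the cells of the
   carpet F draw the letter N.  Consecutive
   columns of cells meet in a set with several points, except columns c and c + 1
   with c = 1 mod 3, which meet only in the point (c + 1, c + 1) / N: these m
   points cut F.

   Let G be the union of all images under words in the phi_i of the left edge,
   the right edge and the main diagonal of the unit square.  Then F is the
   closure of G, so for other y it is enough to connect G \ {y}.  A vertical
   stack of at least two copies of G survives the removal of one point: a broken
   edge is reconnected to the opposite one through the diagonals, and its end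
   (0, 1) (or (1, 0)) through the tiny diagonal of a corner cell of size N^-n and
   the vertical segment x = N^-n (or x = 1 - N^-n).  Neighbouring columns then
   share a point other than y, and by induction on words every point of G \ {y}
   is linked in G \ {y} to a vertical edge of the unit square. *)

Require Import Defs.
From mathcomp Require Import all_boot all_order all_algebra.
From mathcomp Require Import all_classical all_reals all_analysis.
From mathcomp Require Import ring lra zify.
Import Order.TTheory GRing.Theory Num.Theory.
Import numFieldNormedType.Exports.

Local Open Scope classical_set_scope.
Local Open Scope card_scope.
Local Open Scope ring_scope.

Set Implicit Arguments.
Unset Strict Implicit.
Unset Printing Implicit Defensive.

(** * Connectedness in general topological spaces *)

(** A nonempty relatively clopen part of [B] meets [A] by density, so it contains [A], and being
    relatively closed it is all of [B]. *)
Lemma connected_between (T : topologicalType) (A B : set T) :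
  A `<=` B -> B `<=` closure A -> connected A -> connected B.
Proof.
move=> AB BA cA U U0 [C1 oC1 C1E] [C2 cC2 C2E].
suff AC2 : A `<=` C2.
  rewrite C2E; apply/seteqP; split=> [x []//|x Bx]; split=> //.
  by have /BA/(closureS AC2) := Bx; rewrite -(iffLR (closure_id _) cC2).
suff <- : A `&` C1 = A.
  move=> x [Ax C1x]; suff : (B `&` C2) x by case.
  by rewrite -C2E C1E; split=> //; exact: AB.
apply: cA.
- move: U0; rewrite C1E => -[z [/BA Az C1z]].
  by have [w [Aw C1w]] := Az C1 (open_nbhs_nbhs (conj oC1 C1z)); exists w.
- by exists C1.
- exists C2 => //; rewrite -(setIidl AB) -!setIA.
  by rewrite -C1E C2E.
Qed.

Lemma connected_all_components (T : topologicalType) (A : set T) :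
  (forall x y, A x -> A y -> connected_component A x y) -> connected A.
Proof.
move=> cA; have [->|/set0P[x Ax]] := eqVneq A set0; first exact: connected0.
rewrite (_ : A = connected_component A x); first exact: component_connected.
apply/seteqP; split; last exact: connected_component_sub.
by move=> y; exact: cA.
Qed.

Lemma connected_component_image (T U : topologicalType) (f : T -> U)
    (A : set T) (B : set U) (x y : T) :
  continuous f -> f @` A `<=` B ->
  connected_component A x y -> connected_component B (f x) (f y).
Proof.
move=> cf AB [C [Cx CA Cc] Cy]; exists (f @` C); last by exists y.
split; first by exists x.
  by move=> _ [z Cz <-]; apply: AB; exists z => //; exact: CA.
by apply: connected_continuous_connected => //; exact: continuous_subspaceT.
Qed.

(** * Segments in the plane and uniqueness of the self-similar compact set *)

Section plane.
Variable R : realType.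
Implicit Types (p q y : R * R) (A : set (R * R)).

Lemma affine_continuous (a b : R) : continuous (fun t : R => a + t * b).
Proof.
move=> t; apply: (@cvgD R R R (nbhs t) _ (fun=> a) (fun t => t * b)).
  exact: cvg_cst.
by apply: (@cvgM R R (nbhs t) _ id (fun=> b)); [exact: cvg_id|exact: cvg_cst].
Qed.

Lemma segment_component A p q :
  (forall t : R, 0 <= t <= 1 ->
     A (p.1 + t * (q.1 - p.1), p.2 + t * (q.2 - p.2))) ->
  connected_component A p q.
Proof.
case: p q => [p1 p2] [q1 q2] /= pqA.
pose f (t : R) : R * R := (p1 + t * (q1 - p1), p2 + t * (q2 - p2)).
have cf : continuous f.
  move=> t; exact: (cvg_pair (@affine_continuous p1 (q1 - p1) t)
    (@affine_continuous p2 (q2 - p2) t)).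
have f0 : f 0 = (p1, p2) by rewrite /f !mul0r !addr0.
have f1 : f 1 = (q1, q2) by rewrite /f !mul1r ![_ + (_ - _)]addrC !subrK.
rewrite -f0 -f1; apply: (@connected_component_image _ _ f `[0, 1]%classic) => //.
  by move=> _ [t /= + <-]; rewrite in_itv/=; exact: pqA.
rewrite connected_component_id; first by rewrite /= in_itv/= lexx ler01.
  by rewrite /= in_itv/= lexx ler01.
exact: segment_connected.
Qed.

Section GSC.
Variables (N : nat) (D : {set 'I_N * 'I_N}).
Hypothesis N1 : (1 < N)%N.

Lemma phi_continuous (i : 'I_N * 'I_N) : continuous (@phi R N i).
Proof.
have cf (f : R * R -> R) (c : R) :
    continuous f -> continuous (fun x => (f x + c) / N%:R).
  move=> cf x.
  apply: (@cvgM R _ (nbhs x) _ (fun x => f x + c) (fun=> N%:R^-1)).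
    apply: (@cvgD R R _ (nbhs x) _ f (fun=> c)); first exact: cf.
    exact: cvg_cst.
  exact: cvg_cst.
move=> x; apply: (cvg_pair (cf fst i.1%:R _ x) (cf snd i.2%:R _ x)) => {}x.
  exact: cvg_fst.
exact: cvg_snd.
Qed.

Lemma phi_contract (i : 'I_N * 'I_N) p q :
  phi i p - phi i q = (N%:R : R)^-1 *: (p - q).
Proof.
apply: injective_projections; rewrite /= -mulrBl mulrC.
  by congr (_ * _); ring.
by congr (_ * _); ring.
Qed.

(** Applying to [f] the first [n] maps of an address of [x] gives a point of [F] at distance at most
    [(M + |f|) / N ^ n] from [x]. Used in both directions, this gives uniqueness of the carpet. *)
Lemma invariant_subset (K F : set (R * R)) : compact K ->
  F !=set0 -> closed F ->
  K = \bigcup_(i in [set` D]) (phi i @` K) ->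
  F = \bigcup_(i in [set` D]) (phi i @` F) -> K `<=` F.
Proof.
move=> cK [f Ff] cF KE FE.
have /compact_bounded/pinfty_ex_gt0[M _ KM] := cK.
have N0 : (0 : R) < N%:R by rewrite ltr0n; lia.
have main n x : K x -> exists2 q, F q & `|x - q| <= (M + `|f|) / N%:R ^+ n.
  elim: n x => [|n IH] x Kx.
    by exists f => //; rewrite expr0 divr1 (le_trans (ler_normB _ _))// lerD2r KM.
  move: Kx; rewrite {1}KE => -[i Di [x' Kx' <-]].
  have [q Fq xq] := IH _ Kx'; exists (phi i q); first by
    rewrite FE; exists i => //; exists q.
  rewrite phi_contract normrZ ger0_norm ?invr_ge0 ?ler0n// exprS invfM mulrCA.
  by rewrite ler_wpM2l// invr_ge0 ler0n.
move=> x Kx; rewrite (iffLR (closure_id _) cF).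
move=> V /nbhs_ballP[e /= e0 eV].
have M0 : 0 <= M + `|f| by rewrite addr_ge0// (le_trans _ (KM _ Kx)).
(* [upper_nthrootP] bounds the quotient by [2 ^+ n], and [2 <= N]. *)
pose n := Num.bound ((M + `|f|) / e).
have [q Fq xq] := main n x Kx; exists q; split=> //; apply: eV.
rewrite -ball_normE /ball_ /=; apply: le_lt_trans xq _.
rewrite ltr_pdivrMr ?exprn_gt0// mulrC -ltr_pdivrMr//.
apply: lt_le_trans (upper_nthrootP (leqnn n)) _.
by rewrite lerXn2r ?nnegrE ?ler0n// ler_nat.
Qed.

End GSC.
End plane.

(** * The digit set, column by column *)

Definition lo (c : nat) : nat := if (c %% 3 == 2)%N then c else 0.
Definition hi (N c : nat) : nat := if (c %% 3 == 1)%N then c.+1 else N.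

Definition digits (N : nat) : {set 'I_N * 'I_N} :=
  [set i : 'I_N * 'I_N | (lo i.1 <= i.2 < hi N i.1)%N].

Lemma lo_diag c : (lo c <= c)%N.
Proof. by rewrite /lo; case: ifP. Qed.

(** The first two bounds pin down the column just right of the abscissa [(3 * t + 2) / N], whose
    lowest kept cell is the diagonal one; [hi_pivot] is the counterpart on the left. *)
Lemma lo_pivot t c r : (c < (3 * t + 2).+1)%N -> (3 * t + 2 < c.+1)%N ->
  (lo c <= r)%N -> (3 * t + 2 <= r)%N.
Proof.
move=> ct tc; have -> : c = (3 * t + 2)%N by lia.
by rewrite /lo (_ : _ %% 3 = 2)%N//; lia.
Qed.

Lemma hi_pivot N t c r : (c < 3 * t + 2)%N -> ((3 * t + 2).-1 < c.+1)%N ->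
  (r < hi N c)%N -> (r < 3 * t + 2)%N.
Proof.
move=> ct tc; have -> : c = (3 * t + 1)%N by lia.
by rewrite /hi (_ : _ %% 3 = 1)%N /= ; lia.
Qed.

Section carpet.
Variables (R : realType) (m : nat).
Hypothesis m0 : (0 < m)%N.
Let N := (3 * m).+1.
Implicit Types (p q y : R * R) (A : set (R * R)).

Let N4 : (3 < N)%N. Proof. by rewrite /N; lia. Qed.

Let NR4 : 4 <= N%:R :> R.
Proof. by rewrite ler_nat. Qed.

Let NR0 : 0 < N%:R :> R.
Proof. by rewrite ltr0n. Qed.

Let scale_unit (v : R) : 0 <= v <= 1 -> 0%:R <= v * N%:R <= N%:R.
Proof.
by move=> /andP[v0 v1]; rewrite mulr_ge0 ?ler0n//= ler_piMl ?ler0n.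
Qed.

Lemma hi_diag c : (c < N)%N -> (c < hi N c)%N.
Proof. by rewrite /hi; case: ifP. Qed.

Lemma hi_le c : (c < N)%N -> (hi N c <= N)%N.
Proof. by rewrite /hi; case: ifP. Qed.

(** Two cells in every column are what [stack_edges_linked] asks for. *)
Lemma lo_hi c : (c < N)%N -> ((lo c).+1 < hi N c)%N.
Proof.
rewrite /lo /hi /N; case: ifPn; case: ifPn; move=> /eqP ? /eqP ? cN.
- by lia.
- by lia.
- by lia.
- by move: m0 => ?; lia.
Qed.

(** * The skeleton and its self-similarity *)

Definition cell (c r : nat) p : R * R :=
  ((p.1 + c%:R) / N%:R, (p.2 + r%:R) / N%:R).

(** The set G of the overview. The last constructor closes it under the maps, so induction on words
    is induction on derivations. *)
Inductive skeleton : R * R -> Prop :=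
| skeleton_left p of p.1 = 0 & 0 <= p.2 <= 1 : skeleton p
| skeleton_right p of p.1 = 1 & 0 <= p.2 <= 1 : skeleton p
| skeleton_diag p of p.1 = p.2 & 0 <= p.2 <= 1 : skeleton p
| skeleton_cell c r p of (c < N)%N & (lo c <= r < hi N c)%N & skeleton p :
    skeleton (cell c r p).

Lemma mem_skeleton_cell c r x v : (c < N)%N -> (lo c <= r < hi N c)%N ->
  skeleton (x * N%:R - c%:R, v * N%:R - r%:R) -> skeleton (x, v).
Proof.
move=> cN rc /(skeleton_cell cN rc); rewrite /cell /= !subrK.
by rewrite !mulfK// gt_eqF.
Qed.

(** Unlike with the floor, [u = b] goes to [b - 1] with remainder 1, so that the top end of a column
    still falls into a kept cell. *)
Lemma nat_floor (a b : nat) (u : R) : (a < b)%N -> a%:R <= u <= b%:R ->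
  exists2 r : nat, (a <= r < b)%N & 0 <= u - r%:R <= 1.
Proof.
elim: b => // b IH ab /andP[au ub].
have [ub'|bu] := lerP u b%:R.
  have [ab'|ba] := ltnP a b.
    by have [|r rab ru] := IH ab'; [rewrite au|exists r => //; lia].
  exists a; rewrite ?leqnn//.
  have : (b%:R : R) <= a%:R by rewrite ler_nat.
  by lra.
exists b; first by lia.
by move: ub; rewrite -natr1; lra.
Qed.

Lemma skeleton_box p : skeleton p -> 0 <= p.1 <= 1 /\ 0 <= p.2 <= 1.
Proof.
elim=> {p} [p p1 p2|p p1 p2|p p1 p2|c r p cN /andP[_ rh] _ [p1 p2]];
  [by split; lra..|].
have bnd (k : nat) (x : R) : (k < N)%N -> 0 <= x <= 1 ->
    0 <= (x + k%:R) / N%:R <= 1.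
  move=> kN x01; have : (k.+1%:R : R) <= N%:R by rewrite ler_nat.
  have : 0 <= k%:R :> R by rewrite ler0n.
  rewrite -natr1 => k0 kN'; rewrite divr_ge0/= ?ler0n//; last by lra.
  by rewrite ler_pdivrMr// mul1r; lra.
by split; apply: bnd => //; exact: leq_trans rh (hi_le cN).
Qed.

(** Columns 0 and [3 * m] are full and every diagonal cell is kept, so the edges and the diagonal of
    the square split into edges and diagonals of kept cells. *)
Lemma skeleton_cover p : skeleton p ->
  exists c r q,
    [/\ (c < N)%N, (lo c <= r < hi N c)%N, skeleton q & p = cell c r q].
Proof.
have edge (c : nat) (x v : R) : (c < N)%N -> lo c = 0%N -> hi N c = N ->
    (forall w, 0 <= w <= 1 -> skeleton (x, w)) -> 0 <= v <= 1 ->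
    exists c' r q, [/\ (c' < N)%N, (lo c' <= r < hi N c')%N, skeleton q &
      ((x + c%:R) / N%:R, v) = cell c' r q].
  move=> cN c0 ch xG v01; have [|r rN vr] := @nat_floor 0 N (v * N%:R) (ltn0Sn _).
    exact: scale_unit.
  exists c, r, (x, v * N%:R - r%:R); split => //; first by rewrite c0 ch.
    exact: xG.
  by rewrite /cell /= subrK mulfK// gt_eqF.
case=> {p} [[x v]|[x v]|[x v]|c r p cN rc pG] /=.
- move=> -> v01; have <- : (0 + 0%:R) / N%:R = 0 :> R by rewrite addr0 mul0r.
  by apply: edge => // w w01; exact: skeleton_left.
- move=> -> v01; have <- : (1 + (3 * m)%:R) / N%:R = 1 :> R.
    by rewrite addrC natr1 divff// gt_eqF.
  apply: edge => //; rewrite /lo /hi ?modnMr// => w w01.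
  exact: skeleton_right.
- move=> -> v01; have [|r rN vr] := @nat_floor 0 N (v * N%:R) (ltn0Sn _).
    exact: scale_unit.
  exists r, r, (v * N%:R - r%:R, v * N%:R - r%:R); split => //.
  + by rewrite lo_diag hi_diag.
  + exact: skeleton_diag.
  + by rewrite /cell /= subrK mulfK// gt_eqF.
- by exists c, r, p.
Qed.

(** Column 0 is full, so the copies of the segment in its [N] cells add up to a whole vertical
    segment. *)
Lemma skeleton_first_column x : (forall v, 0 <= v <= 1 -> skeleton (x, v)) ->
  forall v, 0 <= v <= 1 -> skeleton (x / N%:R, v).
Proof.
move=> xG v v01; have [|r rN vr] := @nat_floor 0 N (v * N%:R) (ltn0Sn _).
  exact: scale_unit.
apply: (@mem_skeleton_cell 0 r) => //.
by rewrite divfK ?gt_eqF// subr0; exact: xG.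
Qed.

Lemma skeleton_last_column x : (forall v, 0 <= v <= 1 -> skeleton (1 - x, v)) ->
  forall v, 0 <= v <= 1 -> skeleton (1 - x / N%:R, v).
Proof.
move=> xG v v01; have [|r rN vr] := @nat_floor 0 N (v * N%:R) (ltn0Sn _).
  exact: scale_unit.
apply: (@mem_skeleton_cell (3 * m) r) => //.
  by rewrite /lo /hi ?modnMr.
rewrite mulrBl divfK ?gt_eqF// mul1r.
rewrite (_ : N%:R - x - _ = 1 - x); first exact: xG.
by rewrite /N -natr1; ring.
Qed.

Lemma skeleton_ladder_left n v : 0 <= v <= 1 -> skeleton (N%:R ^- n, v).
Proof.
elim: n v => [|n IH] v v01; first by apply: skeleton_right; rewrite //= expr0 invr1.
by rewrite exprSr invfM; exact: skeleton_first_column.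
Qed.

Lemma skeleton_ladder_right n v : 0 <= v <= 1 -> skeleton (1 - N%:R ^- n, v).
Proof.
elim: n v => [|n IH] v v01.
  by apply: skeleton_left; rewrite //= expr0 invr1 subrr.
by rewrite exprSr invfM; exact: skeleton_last_column.
Qed.

(** This is the main diagonal after [n] applications of the top left map, with digit [(0, 3 * m)]: a
    short crossing from the left edge to the top. *)
Lemma skeleton_corner_left n t : 0 <= t <= 1 ->
  skeleton (t * N%:R ^- n, 1 - N%:R ^- n + t * N%:R ^- n).
Proof.
elim: n => [|n IH] t01.
  by apply: skeleton_diag; rewrite /= expr0 invr1; lra.
apply: (@mem_skeleton_cell 0 (3 * m)) => //; first by rewrite /lo /hi /=; lia.
rewrite exprSr invfM mulrA divfK ?gt_eqF// subr0.
rewrite (_ : _ - _ = 1 - N%:R ^- n + t * N%:R ^- n); first exact: IH.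
rewrite mulrDl mulrBl !divfK ?gt_eqF// mul1r.
by rewrite [in X in X - _ + _]/N -natr1; ring.
Qed.

Lemma skeleton_corner_right n t : 0 <= t <= 1 ->
  skeleton (1 - N%:R ^- n + t * N%:R ^- n, t * N%:R ^- n).
Proof.
elim: n => [|n IH] t01.
  by apply: skeleton_diag; rewrite /= expr0 invr1; lra.
apply: (@mem_skeleton_cell (3 * m) 0) => //; first by rewrite /lo /hi ?modnMr.
rewrite exprSr invfM mulrA divfK ?gt_eqF// subr0.
rewrite (_ : _ - _ = 1 - N%:R ^- n + t * N%:R ^- n); first exact: IH.
rewrite mulrDl mulrBl !divfK ?gt_eqF// mul1r.
by rewrite [in X in X - _ + _]/N -natr1; ring.
Qed.

Lemma small_power (d : R) : 0 < d ->
  exists2 n, N%:R ^- n < d & 0 < (N%:R ^- n : R) <= 1.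
Proof.
move=> d0; exists (Num.bound d^-1).
  rewrite -[ltRHS]invrK ltf_pV2 ?posrE ?invr_gt0 ?exprn_gt0//.
  apply: lt_le_trans (upper_nthrootP (leqnn _)) _.
  by rewrite lerXn2r ?nnegrE ?ler0n//; move: NR4; lra.
rewrite invr_gt0 exprn_gt0//= invf_le1 ?exprn_gt0// exprn_ege1//.
by move: NR4; lra.
Qed.

(** * Links between the vertical edges of a stack of cells *)

Lemma component_via q A p y : connected_component A p q ->
  connected_component A q y -> connected_component A p y.
Proof. exact: connected_component_trans. Qed.

Lemma left_ladder (d : R) : 0 < d -> exists e : R, [/\ 0 < e <= 1, e < d,
  (forall v, 0 <= v <= 1 -> skeleton (e, v)) &
  (forall t, 0 <= t <= 1 -> skeleton (t * e, 1 - e + t * e))].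
Proof.
move=> /small_power[n nd n01]; exists (N%:R ^- n); split => //.
  exact: skeleton_ladder_left.
exact: skeleton_corner_left.
Qed.

Lemma right_ladder (d : R) : 0 < d -> exists e : R, [/\ 0 < e <= 1, e < d,
  (forall v, 0 <= v <= 1 -> skeleton (1 - e, v)) &
  (forall t, 0 <= t <= 1 -> skeleton (1 - e + t * e, t * e))].
Proof.
move=> /small_power[n nd n01]; exists (N%:R ^- n); split => //.
  exact: skeleton_ladder_right.
exact: skeleton_corner_right.
Qed.

(** The route goes down the left edge to (0, 1 - e), up the tiny diagonal to (e, 1), down the line x
    = e to the main diagonal, and along it to (1, 1). The choice [e < 1 - h] keeps the removed point
    below (0, 1 - e). *)
Lemma corner_left_linked (h : R) : h < 1 ->
  connected_component (skeleton `\ (0, h)) (0, 1) (1, 1).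
Proof.
move=> h1; have [|e [e01 eh ladder corner]] := @left_ladder (1 - h).
  by rewrite subr_gt0.
apply: (@component_via (0, 1 - e)).
  apply: segment_component => t t01 /=; split; last by case; nra.
  by apply: skeleton_left => /=; nra.
apply: (@component_via (e, 1)).
  apply: segment_component => t t01 /=; split; last by case; nra.
  by have := corner _ t01; congr (skeleton (_, _)); ring.
apply: (@component_via (e, e)).
  apply: segment_component => t t01 /=; split; last by case; nra.
  by rewrite subrr mulr0 addr0; apply: ladder; nra.
apply: segment_component => t t01 /=; split; last by case; nra.
by apply: skeleton_diag => //=; nra.
Qed.

(** The route of [corner_left_linked] after a half turn of the square. *)
Lemma corner_right_linked (h : R) : 0 < h ->
  connected_component (skeleton `\ (1, h)) (1, 0) (0, 0).
Proof.
move=> /right_ladder[e [e01 eh ladder corner]].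
apply: (@component_via (1, e)).
  apply: segment_component => t t01 /=; split; last by case; nra.
  by apply: skeleton_right => /=; nra.
apply: (@component_via (1 - e, 0)).
  apply: segment_component => t t01 /=; split; last by case; nra.
  have /corner : 0 <= 1 - t <= 1 by lra.
  by congr (skeleton (_, _)); ring.
apply: (@component_via (1 - e, 1 - e)).
  apply: segment_component => t t01 /=; split; last by case; nra.
  by rewrite subrr mulr0 addr0; apply: ladder; nra.
apply: segment_component => t t01 /=; split; last by case; nra.
by apply: skeleton_diag => //=; nra.
Qed.

(** A column of cells, in coordinates where each cell is a unit square. *)
Definition stack (a b : nat) : set (R * R) :=
  [set p | exists2 r : nat, (a <= r < b)%N & skeleton (p.1, p.2 - r%:R)].

Lemma stack_left a b p : (a < b)%N -> p.1 = 0 -> a%:R <= p.2 <= b%:R ->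
  stack a b p.
Proof.
move=> ab p1 p2; have [r rab pr] := nat_floor ab p2.
by exists r => //; apply: skeleton_left.
Qed.

Lemma stack_right a b p : (a < b)%N -> p.1 = 1 -> a%:R <= p.2 <= b%:R ->
  stack a b p.
Proof.
move=> ab p1 p2; have [r rab pr] := nat_floor ab p2.
by exists r => //; apply: skeleton_right.
Qed.

Lemma stack_linked a b r y p q : (a <= r < b)%N ->
  connected_component (skeleton `\ (y.1, y.2 - r%:R)) p q ->
  connected_component (stack a b `\ y) (p.1, p.2 + r%:R) (q.1, q.2 + r%:R).
Proof.
move=> rab; apply: (@connected_component_image _ _
  (fun p : R * R => (p.1, p.2 + r%:R))) => [x|].
  have c2 : (p.2 + r%:R @[p --> x]) --> x.2 + r%:R.
    apply: (@cvgD R R _ (nbhs x) _ snd (fun=> r%:R)); first exact: cvg_snd.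
    exact: cvg_cst.
  exact: (cvg_pair (cvg_fst (F := nbhs x.1) (G := nbhs x.2)) c2).
move=> _ [[u v] [Guv uvy] <-] /=; split; first by exists r => //=; rewrite addrK.
by move=> yE; apply: uvy; rewrite -yE /= addrK.
Qed.

Lemma stack_diag a b r y : (a <= r < b)%N ->
  (forall t : R, 0 <= t <= 1 -> (t, r%:R + t) <> y) ->
  connected_component (stack a b `\ y) (0, r%:R) (1, r%:R + 1).
Proof.
move=> rab ty; apply: segment_component => t t01 /=.
rewrite [in X in (X, _)]subr0 mulr1 add0r [r%:R + 1]addrC addrK mulr1.
split; last exact: ty.
by exists r => //=; apply: skeleton_diag => /=; [ring|lra].
Qed.

(** All edge points are joined to a hub [z]. If [y] is on one vertical edge, the hub is on the
    other, and the two parts of the broken edge cross separately, one by a diagonal and one by a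
    corner detour. Otherwise both edges are intact and some diagonal misses [y]. *)
Lemma stack_edges_linked a b y p q : (a.+1 < b)%N ->
  (p.1 = 0 \/ p.1 = 1) -> a%:R <= p.2 <= b%:R -> p <> y ->
  (q.1 = 0 \/ q.1 = 1) -> a%:R <= q.2 <= b%:R -> q <> y ->
  connected_component (stack a b `\ y) p q.
Proof.
move=> ab.
have abR : a%:R + 2 <= b%:R :> R by rewrite -natrD ler_nat; lia.
have ab' : (a < b)%N by lia.
suff [z zP] : exists z, forall p, p.1 = 0 \/ p.1 = 1 -> a%:R <= p.2 <= b%:R ->
    p <> y -> connected_component (stack a b `\ y) z p.
  move=> p1 p2 py q1 q2 qy; apply: (@component_via z).
    exact/connected_component_sym/zP.
  exact: zP.
have left_line u v :
    (forall t : R, 0 <= t <= 1 -> u + t * (v - u) = y.2 -> y.1 <> 0) ->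
    a%:R <= u <= b%:R -> a%:R <= v <= b%:R ->
    connected_component (stack a b `\ y) (0, u) (0, v).
  move=> uvy uab vab; apply: segment_component => t t01 /=; split.
    by apply: stack_left => //=; [ring|nra].
  move=> yE; apply: (uvy t) => //; rewrite -yE //=; ring.
have right_line u v :
    (forall t : R, 0 <= t <= 1 -> u + t * (v - u) = y.2 -> y.1 <> 1) ->
    a%:R <= u <= b%:R -> a%:R <= v <= b%:R ->
    connected_component (stack a b `\ y) (1, u) (1, v).
  move=> uvy uab vab; apply: segment_component => t t01 /=; split.
    by apply: stack_right => //=; [ring|nra].
  move=> yE; apply: (uvy t) => //; rewrite -yE //=; ring.
have [y0|/eqP y0] := eqVneq y.1 0.
  have y1 : y.1 <> 1 by move=> y1; lra.
  exists (1, a%:R) => -[p1 p2] /= [->|->] pab py; last first.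
    by apply: right_line => //; lra.
  have [y2p|py2] := ltP y.2 p2.
    apply: (@component_via (1, b%:R)).
      by apply: right_line => //; lra.
    apply/connected_component_sym.
    apply: (@component_via (0, b%:R)).
      by apply: left_line => //; [move=> t t01 tE; exfalso; nra|lra].
    (* The corner detour takes place in the top cell of the stack, row [b - 1]. *)
    have bE : b%:R = 1 + b.-1%:R :> R by rewrite addrC natr1 prednK//; lia.
    rewrite bE; apply: (@stack_linked _ _ _ _ (0, 1) (1, 1)); first by lia.
    by rewrite y0; apply: corner_left_linked; lra.
  have {}py2 : p2 < y.2.
    rewrite lt_neqAle py2 andbT; apply/eqP => p2E; apply: py.
    by rewrite p2E -y0 -surjective_pairing.
  apply: (@component_via (1, a%:R + 1)).
    by apply: right_line => //; lra.
  apply/connected_component_sym.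
  apply: (@component_via (0, a%:R)).
    by apply: left_line => //; [move=> t t01 tE; exfalso; nra|lra].
  apply: stack_diag; first by lia.
  by move=> t t01 yE; move: y0 py2; rewrite -yE /=; lra.
have [y1|/eqP y1] := eqVneq y.1 1.
  exists (0, a%:R) => -[p1 p2] /= [->|->] pab py.
    by apply: left_line => //; lra.
  have [y2p|py2] := ltP p2 y.2.
    apply/connected_component_sym.
    apply: (@component_via (1, a%:R)).
      by apply: right_line => //; [move=> t t01 tE; exfalso; nra|lra].
    rewrite -[a%:R]add0r; apply: (@stack_linked _ _ _ _ (1, 0) (0, 0)); first by lia.
    by rewrite y1; apply: corner_right_linked; lra.
  have {}py2 : y.2 < p2.
    rewrite lt_neqAle py2 andbT; apply/eqP => p2E; apply: py.
    by rewrite -p2E -y1 -surjective_pairing.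
  apply: (@component_via (0, b.-1%:R)).
    apply: left_line => //; first by lra.
    by rewrite !ler_nat; lia.
  have bE : b%:R = b.-1%:R + 1 :> R by rewrite natr1 prednK//; lia.
  apply: (@component_via (1, b%:R)).
    rewrite bE; apply: stack_diag; first by lia.
    by move=> t t01 yE; move: y1 py2; rewrite -yE /=; lra.
  by apply: right_line => //; [move=> t t01 tE; exfalso; nra|lra].
exists (0, a%:R) => -[p1 p2] /= [->|->] pab py.
  by apply: left_line => //; lra.
(* The diagonals of rows [a] and [a + 1] lie on distinct parallel lines, so one of them misses
   [y]. *)
have [r rab ry] : exists2 r : nat, (a <= r < b)%N & y.1 + r%:R <> y.2.
  have [ya|/eqP ya] := eqVneq (y.1 + a%:R) y.2; last by exists a => //; lia.
  by exists a.+1; [lia|rewrite -natr1 -ya; lra].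
have rabR : a%:R <= (r%:R : R) <= b%:R - 1.
  by rewrite lerBrDr natr1 !ler_nat; lia.
apply: (@component_via (0, r%:R)).
  by apply: left_line => //; lra.
apply: (@component_via (1, r%:R + 1)).
  apply: stack_diag => // t t01 yE.
  by apply: ry; rewrite -yE /= addrC.
by apply: right_line => //; lra.
Qed.

(** * Columns of the carpet and the passage between them *)

Lemma cell_continuous c r : (c < N)%N -> (r < N)%N -> continuous (cell c r).
Proof. by move=> cN rN; exact: (@phi_continuous R N (Ordinal cN, Ordinal rN)). Qed.

Definition uncell (c r : nat) p : R * R :=
  (p.1 * N%:R - c%:R, p.2 * N%:R - r%:R).

Lemma cellK c r : cancel (cell c r) (uncell c r).
Proof. by case=> u v; rewrite /uncell /cell /= !divfK ?gt_eqF// !addrK. Qed.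

Lemma uncellK c r : cancel (uncell c r) (cell c r).
Proof. by case=> u v; rewrite /uncell /cell /= !subrK !mulfK// gt_eqF. Qed.

Lemma cell_component c r A B p q : (c < N)%N -> (r < N)%N ->
  cell c r @` A `<=` B -> connected_component A (uncell c r p) (uncell c r q) ->
  connected_component B p q.
Proof.
move=> cN rN AB; rewrite -{2}(uncellK c r p) -{2}(uncellK c r q).
by apply: connected_component_image => //; exact: cell_continuous.
Qed.

(** The vertical sides of the union of the kept cells of column [c]. *)
Definition column_edge (c : nat) : set (R * R) :=
  [set p | (p.1 = c%:R / N%:R \/ p.1 = c.+1%:R / N%:R) /\
           (lo c)%:R <= p.2 * N%:R <= (hi N c)%:R].

Lemma column_edge_linked c y p q : (c < N)%N ->
  column_edge c p -> p <> y -> column_edge c q -> q <> y ->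
  connected_component (skeleton `\ y) p q.
Proof.
move=> cN [p1 p2] py [q1 q2] qy.
have N0 : (0 < N)%N by [].
have x01 (x : R) : x = c%:R / N%:R \/ x = c.+1%:R / N%:R ->
    x * N%:R - c%:R = 0 \/ x * N%:R - c%:R = 1.
  case=> ->; rewrite divfK ?gt_eqF//; [left|right]; first by rewrite subrr.
  by rewrite -natr1 addrAC subrr add0r.
(* [cell c 0] maps the whole stack onto column [c], the row being absorbed in the second
   coordinate. *)
apply: (@cell_component c 0 (stack (lo c) (hi N c) `\ uncell c 0 y)) => //.
  move=> _ [[u v] [[r rc Guv] uvy] <-]; split.
    have -> : cell c 0 (u, v) = cell c r (u, v - r%:R).
      by rewrite /cell /= addr0 subrK.
    exact: skeleton_cell.
  by move=> yE; apply: uvy; rewrite -yE cellK.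
apply: stack_edges_linked.
- exact: lo_hi.
- exact: x01.
- by rewrite /= subr0.
- by move=> /(can_inj (uncellK c 0)) pE; apply: py.
- exact: x01.
- by rewrite /= subr0.
- by move=> /(can_inj (uncellK c 0)) qE; apply: qy.
Qed.

Definition pivot (k : nat) : R * R := (k%:R / N%:R, k%:R / N%:R).

Lemma pivot_inj : injective pivot.
Proof.
move=> j k [/(mulIf _) jk _]; apply/eqP; rewrite -(eqr_nat R); apply/eqP/jk.
by rewrite invr_eq0 gt_eqF.
Qed.

(** The pivot [c.+1] lies on both columns. If it is [y], another common point is at height 0 when c
    = 0 mod 3 and at height 1 when c = 2 mod 3. *)
Lemma column_edgeI (c : nat) y : (c.+1 < N)%N ->
  ~ ((c %% 3 = 1)%N /\ y = pivot c.+1) ->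
  exists z, [/\ column_edge c z, column_edge c.+1 z & z <> y].
Proof.
move=> cN cy; have cN' : (c < N)%N by exact: ltnW.
have share (k : nat) : (lo c <= k <= hi N c)%N ->
    (lo c.+1 <= k <= hi N c.+1)%N ->
    column_edge c (c.+1%:R / N%:R, k%:R / N%:R) /\
    column_edge c.+1 (c.+1%:R / N%:R, k%:R / N%:R).
  move=> kc kc1; split; split=> /=; try by [left|right].
    by rewrite divfK ?gt_eqF// !ler_nat.
  by rewrite divfK ?gt_eqF// !ler_nat.
have piv : column_edge c (pivot c.+1) /\ column_edge c.+1 (pivot c.+1).
  apply: share; rewrite ?lo_diag ?hi_diag ?andbT//=.
    by rewrite (leq_trans (lo_diag c)).
  by rewrite ltnW ?hi_diag.
have [yE|] := pselect (y = pivot c.+1); last first.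
  by move=> yp; exists (pivot c.+1); case: piv => ? ?; split=> // zy; apply: yp.
have c3 : (c %% 3 <> 1)%N by move=> c3; apply: cy.
have other (k : nat) : k <> c.+1 -> (lo c <= k <= hi N c)%N ->
    (lo c.+1 <= k <= hi N c.+1)%N ->
    exists z, [/\ column_edge c z, column_edge c.+1 z & z <> y].
  move=> kc k1 k2; have [e1 e2] := share k k1 k2.
  exists (c.+1%:R / N%:R, k%:R / N%:R); split => //; rewrite yE => -[] /mulIf kE.
  apply: kc; apply/eqP; rewrite -(eqr_nat R); apply/eqP/kE.
  by rewrite invr_eq0 gt_eqF.
have c13 : (c.+1 %% 3 = (c %% 3).+1 %% 3)%N by lia.
have [c0|c0] := eqVneq (c %% 3)%N 0.
  by apply: (other 0%N) => //; rewrite /lo ?c13 c0.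
have {}c0 : (c %% 3 = 2)%N by lia.
apply: (other N); first by move=> NE; rewrite NE ltnn in cN.
  by rewrite /lo /hi c0 /= ltnW//= leqnn.
by rewrite /lo /hi c13 c0 /= leqnn.
Qed.

(** Columns are crossed one at a time, through common points given by [column_edgeI]. *)
Lemma chain_linked (c k : nat) y p q : (c + k < N)%N ->
  (forall j, (c <= j < c + k)%N -> ~ ((j %% 3 = 1)%N /\ y = pivot j.+1)) ->
  column_edge c p -> p <> y -> column_edge (c + k) q -> q <> y ->
  connected_component (skeleton `\ y) p q.
Proof.
elim: k q => [|k IH] q ckN free pc py qk qy.
  by rewrite addn0 in ckN qk; apply: column_edge_linked pc py qk qy.
rewrite addnS in ckN free qk.
have [|z [zk zk1 zy]] := column_edgeI ckN (y := y).
  by apply: free; rewrite leq_addr/=.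
apply: (@component_via z); last exact: column_edge_linked zk1 zy qk qy.
by apply: IH => // [|j jc]; [exact: ltnW|apply: free; lia].
Qed.

Lemma column_edge_first p : p.1 = 0 -> 0 <= p.2 <= 1 -> column_edge 0 p.
Proof.
move=> p1 p2; split; first by left; rewrite p1 mul0r.
exact: scale_unit.
Qed.

Lemma column_edge_last p : p.1 = 1 -> 0 <= p.2 <= 1 -> column_edge (3 * m) p.
Proof.
move=> p1 p2; split; first by right; rewrite p1 divff// gt_eqF.
by rewrite /lo /hi modnMr; exact: scale_unit.
Qed.

Lemma vertical_avoid (x : R) y : exists2 v : R, 0 <= v <= 1 & (x, v) <> y.
Proof.
have [->|/eqP y0] := eqVneq y (x, 0); first by exists 1; [lra|case; lra].
by exists 0; [lra|move=> yE; apply: y0].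
Qed.

(** The side is left open because [y] may be a cutting pivot; in the induction [uncell c r y] may be
    one even if [y] is not. A point of a cell first reaches a side of that cell, then walks along
    the columns. *)
Lemma skeleton_linked_side p y : skeleton p -> p <> y ->
  exists q, [/\ q.1 = 0 \/ q.1 = 1, 0 <= q.2 <= 1, q <> y &
    connected_component (skeleton `\ y) p q].
Proof.
move=> Gp; elim: Gp y => {p} [p p1 p2|p p1 p2|p p1 p2|c r p cN rc Gp IH] y py.
- exists p; split=> //; first by left.
  by apply: connected_component_refl; split=> //; exact: skeleton_left.
- exists p; split=> //; first by right.
  by apply: connected_component_refl; split=> //; exact: skeleton_right.
- case: p y p1 p2 py => [u v] [y1 y2] /= -> {u} v01 vy.
  (* On the diagonal, move away from the abscissa of [y]: up if it is below [v], down otherwise. *)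
  have [y1v|vy1] := ltP y1 v.
    exists (1, 1); split => /=; [by right|by rewrite lexx ler01|by case; lra|].
    apply: segment_component => t t01 /=; split; last by case; nra.
    by apply: skeleton_diag => //=; nra.
  have [v0|/eqP v0] := eqVneq v 0.
    rewrite v0 in vy *; exists (0, 0); split=> //=; first by left.
      by rewrite lexx ler01.
    apply: connected_component_refl; split=> //.
    by apply: skeleton_left => //=; rewrite lexx ler01.
  exists (0, 0); split => /=; [by left|by rewrite lexx ler01|by case; lra|].
  apply: segment_component => t t01 /=; split.
    by apply: skeleton_diag => //=; nra.
  rewrite !sub0r => -[e1 e2]; apply: vy; congr (_, _); nra.
- have [|q [q1 q2 qy pq]] := IH (uncell c r y).
    by move=> pE; apply: py; rewrite pE uncellK.
  have rN : (r < N)%N.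
    by case/andP: rc => _ /leq_trans; apply; exact: hi_le.
  have {}pq : connected_component (skeleton `\ y) (cell c r p) (cell c r q).
    apply: (@cell_component c r (skeleton `\ uncell c r y)); rewrite ?cellK//.
    move=> _ [z [Gz zy] <-]; split; first exact: skeleton_cell.
    by move=> yE; apply: zy; rewrite -yE cellK.
  have {}qy : cell c r q <> y by move=> yE; apply: qy; rewrite -yE cellK.
  have qc : column_edge c (cell c r q).
    split; rewrite /cell /=.
      by case: q1 => ->; [left; rewrite add0r|right; rewrite addrC natr1].
    rewrite divfK ?gt_eqF//; case/andP: rc; rewrite -(ler_nat R) => rl.
    by rewrite -(ler_nat R) -natr1 => rh; lra.
  suff [z [z1 z2 zy qz]] : exists z, [/\ z.1 = 0 \/ z.1 = 1, 0 <= z.2 <= 1,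
      z <> y & connected_component (skeleton `\ y) (cell c r q) z].
    by exists z; split => //; exact: component_via pq qz.
  (* By [pivot_inj], a pivot that blocks the way left cannot also block the way right. *)
  have [[j [jc j3 yj]]|nj] :=
      pselect (exists j, [/\ (j < c)%N, (j %% 3 = 1)%N & y = pivot j.+1]).
    have [v v01 vy] := vertical_avoid 1 y.
    exists (1, v); split => //; first by right.
    apply: (@chain_linked c (3 * m - c)) => //.
    + by rewrite subnKC// -ltnS.
    + rewrite subnKC -1?ltnS// => i ic [i3]; rewrite yj => /pivot_inj; lia.
    + by rewrite subnKC -1?ltnS//; exact: column_edge_last.
  have [v v01 vy] := vertical_avoid 0 y.
  exists (0, v); split => //; first by left.
  apply: connected_component_sym.
  apply: (@chain_linked 0 c) => //.
  + move=> i ic [i3 yi]; apply: nj; exists i; split => //; lia.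
  + exact: column_edge_first.
Qed.

(** No pivot blocks the chain of all columns, so the left and right edges are linked, and two points
    of one edge are linked via the other; [skeleton_linked_side] brings every point to an edge. *)
Lemma skeleton_connected y :
  (forall t, (t < m)%N -> y <> pivot (3 * t + 2)) -> connected (skeleton `\ y).
Proof.
move=> ny.
have sides p q : p.1 = 0 \/ p.1 = 1 -> 0 <= p.2 <= 1 -> p <> y ->
    q.1 = 0 \/ q.1 = 1 -> 0 <= q.2 <= 1 -> q <> y ->
    connected_component (skeleton `\ y) p q.
  have lr p' q' : p'.1 = 0 -> 0 <= p'.2 <= 1 -> p' <> y ->
      q'.1 = 1 -> 0 <= q'.2 <= 1 -> q' <> y ->
      connected_component (skeleton `\ y) p' q'.
    move=> p1 p2 py q1 q2 qy; apply: (@chain_linked 0 (3 * m)) => //.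
    + move=> j jm [j3]; rewrite (_ : j.+1 = 3 * (j %/ 3) + 2)%N; last by lia.
      by apply: ny; lia.
    + exact: column_edge_first.
    + exact: column_edge_last.
  move=> [p1|p1] p2 py [q1|q1] q2 qy; last 2 first.
  - exact/connected_component_sym/lr.
  - have [v v01 vy] := vertical_avoid 0 y.
    by apply: (@component_via (0, v)); [apply/connected_component_sym|]; exact: lr.
  - have [v v01 vy] := vertical_avoid 1 y.
    by apply: (@component_via (1, v)); [|apply/connected_component_sym]; exact: lr.
  - exact: lr.
apply: connected_all_components => p q [Gp py] [Gq qy].
have [p' [p1 p2 py' pp]] := skeleton_linked_side Gp py.
have [q' [q1 q2 qy' qq]] := skeleton_linked_side Gq qy.
apply: (component_via pp); apply: (component_via (sides _ _ p1 p2 py' q1 q2 qy')).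
exact: connected_component_sym.
Qed.

(** * The closure of the skeleton is the carpet *)

Lemma closure_skeleton_box p : closure skeleton p ->
  0 <= p.1 <= 1 /\ 0 <= p.2 <= 1.
Proof.
have cbox : closed (`[0 : R, 1]%classic `*` `[0 : R, 1]%classic).
  apply: compact_closed; first exact: norm_hausdorff.
  by apply: compact_setX; exact: segment_compact.
have sbox : skeleton `<=` `[0 : R, 1]%classic `*` `[0 : R, 1]%classic.
  by move=> q /skeleton_box[q1 q2]; split; rewrite /= in_itv.
move=> /(closureS sbox); rewrite -(iffLR (closure_id _) cbox).
by case; rewrite /= !in_itv.
Qed.

Lemma closure_skeleton_compact : compact (closure skeleton).
Proof.
apply: (@subclosed_compact _ _ (`[0 : R, 1]%classic `*` `[0 : R, 1]%classic)).
- exact: closed_closure.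
- by apply: compact_setX; exact: segment_compact.
- by move=> q /closure_skeleton_box[q1 q2]; split; rewrite /= in_itv.
Qed.

(** The union on the right is closed, as a finite union of compact images, and contains the skeleton
    by [skeleton_cover]; conversely, continuity of [phi] carries limits of skeleton points to such
    limits. *)
Lemma closure_skeleton_invariant :
  closure skeleton = \bigcup_(i in [set` digits N]) (phi i @` closure skeleton).
Proof.
apply/seteqP; split.
  have cU : closed (\bigcup_(i in [set` digits N]) (phi i @` closure skeleton)).
    apply: closed_bigcup => [|i _]; first exact: finite_finset.
    apply: compact_closed; first exact: norm_hausdorff.
    apply: continuous_compact closure_skeleton_compact.
    by apply: continuous_subspaceT; exact: phi_continuous.
  rewrite [X in _ `<=` X](iffLR (closure_id _) cU); apply: closureS => p.
  move=> /skeleton_cover[c [r [q [cN rc Gq ->]]]].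
  have rN : (r < N)%N by case/andP: rc => _ /leq_trans; apply; exact: hi_le.
  exists (Ordinal cN, Ordinal rN); first by rewrite /= inE.
  by exists q => //; exact: subset_closure.
move=> _ [[c r] + [q Fq <-]]; rewrite /= inE /= => rc.
move=> V Vp; have [z [Gz Vz]] := Fq _ (@phi_continuous R N (c, r) q V Vp).
exists (phi (c, r) z); split => //.
exact: (skeleton_cell (ltn_ord c) rc Gz).
Qed.

Lemma closure_skeleton_GSC : is_GSC (digits N) (closure skeleton).
Proof.
have F0 : closure skeleton !=set0.
  exists (0, 0); apply: subset_closure; apply: skeleton_left => //=.
  by rewrite lexx ler01.
have FE := closure_skeleton_invariant; have cF := closure_skeleton_compact.
split=> // K [K0 cK KE].
have N1 : (1 < N)%N by exact: ltnW (ltnW N4).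
have clK : closed K by apply: compact_closed => //; exact: norm_hausdorff.
apply/seteqP; split.
  by apply: (invariant_subset N1 cF K0 clK FE KE).
by apply: (invariant_subset N1 cK F0 (@closed_closure _ _) KE FE).
Qed.

Lemma closure_skeleton_connected y :
  (forall t, (t < m)%N -> y <> pivot (3 * t + 2)) ->
  connected (closure skeleton `\ y).
Proof.
move=> /skeleton_connected; apply: connected_between.
  by move=> p [Gp py]; split=> //; exact: subset_closure.
move=> p [Fp py] V Vp.
have oy : open (~` [set y]).
  apply: closed_openC; apply: compact_closed (@compact_set1 _ y).
  exact: norm_hausdorff.
have [z [Gz [Vz zy]]] := Fp _ (filterI Vp (open_nbhs_nbhs (conj oy py))).
by exists z.
Qed.

(** * The cut points *)

Lemma pivot_in t : (t < m)%N -> skeleton (pivot (3 * t + 2)).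
Proof.
move=> tm; apply: skeleton_diag => //=.
by rewrite divr_ge0 ?ler0n//= ler_pdivrMr// mul1r ler_nat /N; lia.
Qed.

(* In the cell column just left of the pivot the carpet lies below the pivot, in
   the one just right of it above. *)
Lemma pivot_cut t : (t < m)%N ->
  ~ connected (closure skeleton `\ pivot (3 * t + 2)).
Proof.
move=> tm; set k := (3 * t + 2)%N; set X := closure _ `\ _ => cX.
have kN : (k.+1 < N)%N by rewrite /k /N; lia.
pose a : R := k%:R / N%:R.
(* [O1] is the part left of the pivot, together with a strip reaching past abscissa [a] that picks
   up the points right below the pivot; [O2] is its half turn about the pivot. *)
pose O1 : set (R * R) := [set p | p.1 < a] `|`
  ([set p | p.1 < k.+1%:R / N%:R] `&` [set p | p.2 < a]).
pose O2 : set (R * R) := [set p | a < p.1] `|`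
  ([set p | k.-1%:R / N%:R < p.1] `&` [set p | a < p.2]).
have open1 (b : R) : open [set p : R * R | p.1 < b].
  apply: (@open_comp _ _ fst [set x | x < b]); last exact: open_lt.
  by move=> p _; exact: cvg_fst.
have open1' (b : R) : open [set p : R * R | b < p.1].
  apply: (@open_comp _ _ fst [set x | b < x]); last exact: open_gt.
  by move=> p _; exact: cvg_fst.
have open2 (b : R) : open [set p : R * R | p.2 < b].
  apply: (@open_comp _ _ snd [set x | x < b]); last exact: open_lt.
  by move=> p _; exact: cvg_snd.
have open2' (b : R) : open [set p : R * R | b < p.2].
  apply: (@open_comp _ _ snd [set x | b < x]); last exact: open_gt.
  by move=> p _; exact: cvg_snd.
have oO1 : open O1 by apply: openU => //; exact: openI.
have oO2 : open O2 by apply: openU => //; exact: openI.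
have a0 : 0 < a by rewrite divr_gt0// ltr0n /k; lia.
have a1 : a < 1 by rewrite ltr_pdivrMr// mul1r ltr_nat; lia.
have aS : a < k.+1%:R / N%:R by rewrite ltr_pM2r ?invr_gt0// ltr_nat.
have aP : k.-1%:R / N%:R < a by rewrite ltr_pM2r ?invr_gt0// ltr_nat /k; lia.
have cells p : X p -> exists c r (u v : R), [/\ (lo c <= r < hi N c)%N,
    0 <= u <= 1, 0 <= v <= 1 & p = ((u + c%:R) / N%:R, (v + r%:R) / N%:R)].
  move=> [+ _]; rewrite {1}closure_skeleton_invariant => -[[c r] + [[u v] + <-]].
  rewrite /= inE /= => rc /closure_skeleton_box[u01 v01].
  by exists c, r, u, v.
have XO12 p : X p -> O1 p -> ~ O2 p.
  move=> /cells[c [r [u [v [/andP[rl rh] u01 v01 ->]]]]].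
  rewrite /O1 /O2 /a /= !ltr_pM2r ?invr_gt0//.
  move=> p1 [p2|[p2l p2r]].
    (* Right of the pivot, [O1] forces column [k] and a height below [a], against [lo_pivot]; the
       case after it is symmetric. *)
    case: p1 => [|[p1l p1r]]; first by lra.
    have ck : (c < k.+1)%N by rewrite -(ltr_nat R); lra.
    have kc : (k < c.+1)%N by rewrite -(ltr_nat R) -natr1; lra.
    have : (k <= r)%N by exact: lo_pivot ck kc rl.
    by rewrite -(ler_nat R); lra.
  have p1' : u + c%:R < k%:R by case: p1 => // -[]; lra.
  have ck : (c < k)%N by rewrite -(ltr_nat R); lra.
  have kc : (k.-1 < c.+1)%N by rewrite -(ltr_nat R) -natr1; lra.
  have : (r.+1 <= k)%N by exact: hi_pivot ck kc rh.
  by rewrite -(ler_nat R) -natr1; lra.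
have XU p : X p -> O1 p \/ O2 p.
  case: p => [u v] [_ uv]; rewrite /O1 /O2 /=.
  case: (ltgtP u a) => [ua|ua|ua]; [by left; left|by right; left|].
  case: (ltgtP v a) => [va|va|va].
  - by left; right; rewrite ua.
  - by right; right; rewrite ua.
  - by exfalso; apply: uv; rewrite ua va.
have X0 : X (0, 0).
  split; last by case=> /eqP; rewrite lt_eqF.
  by apply/subset_closure/skeleton_left => //=; rewrite lexx ler01.
have X1 : X (1, 1).
  split; last by case=> /eqP; rewrite gt_eqF.
  by apply/subset_closure/skeleton_right => //=; rewrite lexx ler01.
(* Connectedness would spread [O1] from (0, 0) to (1, 1), which lies in [O2]. *)
have XE : X `&` O1 = X.
  apply: cX.
  - by exists (0, 0); split => //; left.
  - by exists O1.
  - exists (~` O2); first exact: open_closedC.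
    apply/seteqP; split=> p [Xp Op]; split => //; first exact: XO12.
    by case: (XU p Xp).
have [_ p1] : (X `&` O1) (1, 1) by rewrite XE.
by apply: XO12 X1 p1 _; left.
Qed.

Lemma cut_points_closure_skeleton :
  cut_points (closure skeleton) = (fun t => pivot (3 * t + 2)) @` `I_m.
Proof.
apply/seteqP; split=> [p [Fp]|_ [t tm <-]].
  apply: contra_notP => np; apply: closure_skeleton_connected => t tm pE.
  by apply: np; exists t.
by split; [exact/subset_closure/pivot_in|exact: pivot_cut].
Qed.

Lemma card_digits : (1 < #|digits N| < N ^ 2)%N.
Proof.
have N0 : (0 < N)%N by [].
have N1 : (1 < N)%N by exact: ltnW (ltnW N4).
have N2 : (2 < N)%N by exact: ltnW N4.
apply/andP; split.
  apply/card_gt1P; exists (Ordinal N0, Ordinal N0), (Ordinal N0, Ordinal N1).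
  by rewrite !inE.
rewrite -mulnn -[X in (_ < X * X)%N]card_ord -card_prod -cardsT.
apply: proper_card; rewrite properE finset.subsetT /=; apply/subsetPn.
(* The digit (2, 0) is missing since [lo 2 = 2]. *)
by exists (Ordinal N2, Ordinal N0); rewrite ?inE.
Qed.

End carpet.

Theorem theorem1p4 (R : realType) (m : nat) (hm : (0 < m)%N) :
  exists (N : nat) (D : {set 'I_N * 'I_N}) (F : set (R * R)),
    [/\ (2 <= N)%N,
        (1 < #|D| < N ^ 2)%N,
        is_GSC D F,
        connected F &
        cut_points F #= `I_m].
Proof.
exists (3 * m).+1, (digits (3 * m).+1), (closure (@skeleton R m)); split.
- by lia.
- exact: card_digits.
- exact: closure_skeleton_GSC.
(* As (2, 2) is outside the unit square, removing it changes nothing, and connectedness of the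
   carpet becomes a case of [closure_skeleton_connected]. *)
- have -> : closure (@skeleton R m) = closure (@skeleton R m) `\ (2, 2).
    apply/seteqP; split=> p; last by case.
    by move=> Fp; split => // p2; have [] := closure_skeleton_box Fp; rewrite p2 /=; lra.
  apply: closure_skeleton_connected => // t tm pE.
  have /subset_closure/(closure_skeleton_box)[] := pivot_in R hm tm.
  by rewrite -pE /=; lra.
- rewrite cut_points_closure_skeleton//; apply: inj_card_eq.
  by move=> s t _ _ /pivot_inj; lia.
Qed.
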